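(* Let $A$ be a pseudo-hoop and $\mu$ a compatible type II state operator on $A$, with kernel $K={\rm Ker}(\mu)=\{x\in A\mid\mu(x)=1\}$. Then: (1) the map $\hat\mu:A/K\to A/K$, $\hat\mu(x/K)=\mu(x)/K$, is well defined and is both a compatible type I and a compatible type II state operator on $A/K$; (2) $\mu$ is a compatible type I state operator on $A$.
   Context: A pseudo-hoop is an algebra $(A,\odot,\rightarrow,\rightsquigarrow,1)$ of type $(2,2,2,0)$ such that for all $x,y,z\in A$: $x\odot 1=1\odot x=x$; $x\rightarrow x=x\rightsquigarrow x=1$; $(x\odot y)\rightarrow z=x\rightarrow(y\rightarrow z)$; $(x\odot y)\rightsquigarrow z=y\rightsquigarrow(x\rightsquigarrow z)$; $(x\rightarrow y)\odot x=(y\rightarrow x)\odot y=x\odot(x\rightsquigarrow y)=y\odot(y\rightsquigarrow x)$. The order is $x\le y$ iff $x\rightarrow y=1$. Put $x\vee_1 y=(x\rightarrow y)\rightsquigarrow y$, $x\vee_2 y=(x\rightsquigarrow y)\rightarrow y$. For $\mu:A\to A$ and all $x,y$ consider: (IS1) $\mu(x\rightarrow y)=\mu(x\vee_1 y)\rightarrow\mu(y)$ and $\mu(x\rightsquigarrow y)=\mu(x\vee_2 y)\rightsquigarrow\mu(y)$; (IS1') $\mu(x\rightarrow y)=\mu(y\vee_1 x)\rightarrow\mu(y)$ and $\mu(x\rightsquigarrow y)=\mu(y\vee_2 x)\rightsquigarrow\mu(y)$; (IS2) $\mu(x\odot y)=\mu(x)\odot\mu(x\rightsquigarrow x\odot y)=\mu(y\rightarrow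 x\odot y)\odot\mu(y)$; (IS3) $\mu(\mu(x)\odot\mu(y))=\mu(x)\odot\mu(y)$; (IS4) $\mu(\mu(x)\rightarrow\mu(y))=\mu(x)\rightarrow\mu(y)$ and $\mu(\mu(x)\rightsquigarrow\mu(y))=\mu(x)\rightsquigarrow\mu(y)$. Type I: (IS1),(IS2),(IS3),(IS4); type II: (IS1'),(IS2),(IS3),(IS4). A filter is a nonempty $F\subseteq A$ closed under $\odot$ and upward closed; it is normal if for all $x,y$: $x\rightarrow y\in F$ iff $x\rightsquigarrow y\in F$. A state operator is compatible if its kernel ${\rm Ker}(\mu)$ is a normal filter. For a normal filter $F$, $(x,y)\in\Theta_F$ iff $x\rightarrow y\in F$ and $y\rightarrow x\in F$ defines a congruence; $A/F$ is the quotient pseudo-hoop and $x/F$ the class of $x$. *)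

(* Defs.v *)
From HB Require Import structures.
From mathcomp Require Import all_boot.
From mathcomp Require Import boolp classical_sets.
Set Implicit Arguments.
Unset Strict Implicit.
Unset Printing Implicit Defensive.

Declare Scope hoop_scope.
Delimit Scope hoop_scope with hoop.

HB.mixin Record isPseudoHoop (A : Type) := {
  hmul : A -> A -> A;
  himp : A -> A -> A;
  hpmi : A -> A -> A;
  hone : A;
  hmulx1 : forall x, hmul x hone = x;
  hmul1x : forall x, hmul hone x = x;
  himpxx : forall x, himp x x = hone;
  hpmixx : forall x, hpmi x x = hone;
  himpM : forall x y z, himp (hmul x y) z = himp x (himp y z);
  hpmiM : forall x y z, hpmi (hmul x y) z = hpmi y (hpmi x z);
  hdivC : forall x y, hmul (himp x y) x = hmul (himp y x) y;
  hdivlr : forall x y, hmul (himp y x) y = hmul x (hpmi x y);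
  hdivCr : forall x y, hmul x (hpmi x y) = hmul y (hpmi y x)
}.

#[short(type="pseudoHoopType")]
HB.structure Definition PseudoHoop := {A of isPseudoHoop A}.

Notation "1" := hone : hoop_scope.
Notation "x ⊙ y" := (hmul x y)
  (at level 40, left associativity) : hoop_scope.
Notation "x → y" := (himp x y)
  (at level 55, right associativity) : hoop_scope.
Notation "x ⇝ y" := (hpmi x y)
  (at level 55, right associativity) : hoop_scope.

Local Open Scope hoop_scope.
Local Open Scope classical_set_scope.
Local Open Scope quotient_scope.

Definition hle (A : pseudoHoopType) (x y : A) : Prop := x → y = 1.
Notation "x ≤ y" := (hle x y) (at level 70, no associativity) : hoop_scope.

Definition hvee1 (A : pseudoHoopType) (x y : A) : A := (x → y) ⇝ y.
Definition hvee2 (A : pseudoHoopType) (x y : A) : A := (x ⇝ y) → y.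
Notation "x ∨₁ y" := (hvee1 x y)
  (at level 50, left associativity) : hoop_scope.
Notation "x ∨₂ y" := (hvee2 x y)
  (at level 50, left associativity) : hoop_scope.

Section StateOperators.
Variables (A : pseudoHoopType) (mu : A -> A).

Definition IS1 : Prop := forall x y,
  mu (x → y) = mu (x ∨₁ y) → mu y /\ mu (x ⇝ y) = mu (x ∨₂ y) ⇝ mu y.

Definition IS1' : Prop := forall x y,
  mu (x → y) = mu (y ∨₁ x) → mu y /\ mu (x ⇝ y) = mu (y ∨₂ x) ⇝ mu y.

Definition IS2 : Prop := forall x y,
  mu (x ⊙ y) = mu x ⊙ mu (x ⇝ x ⊙ y) /\
  mu (x ⊙ y) = mu (y → x ⊙ y) ⊙ mu y.

Definition IS3 : Prop := forall x y, mu (mu x ⊙ mu y) = mu x ⊙ mu y.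

Definition IS4 : Prop := forall x y,
  mu (mu x → mu y) = mu x → mu y /\ mu (mu x ⇝ mu y) = mu x ⇝ mu y.

Definition state_operator_I : Prop := [/\ IS1, IS2, IS3 & IS4].
Definition state_operator_II : Prop := [/\ IS1', IS2, IS3 & IS4].

Definition Ker : set A := [set x | mu x = 1].

End StateOperators.

Definition is_filter (A : pseudoHoopType) (F : set A) : Prop :=
  [/\ F !=set0,
      forall x y, F x -> F y -> F (x ⊙ y) &
      forall x y, F x -> x ≤ y -> F y].

Definition normal_filter (A : pseudoHoopType) (F : set A) : Prop :=
  is_filter F /\ forall x y, F (x → y) <-> F (x ⇝ y).

Definition compatible (A : pseudoHoopType) (mu : A -> A) : Prop :=
  normal_filter (Ker mu).

Section Theory.
Variable A : pseudoHoopType.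
Implicit Types x y z u w : A.

Lemma hle_anti x y : x ≤ y -> y ≤ x -> x = y.
Proof. by rewrite /hle => xy yx; have := hdivC x y; rewrite xy yx !hmul1x. Qed.

Lemma himp1x x : 1 → x = x.
Proof.
apply: hle_anti; rewrite /hle; last by rewrite -himpM hmulx1 himpxx.
by rewrite -[X in X → x]hmulx1 himpM himpxx.
Qed.

Lemma himpx1 x : x → 1 = 1.
Proof.
have E : (x → 1) ⊙ x = x by rewrite hdivC hmulx1 himp1x.
by rewrite -{1}E himpM himpxx.
Qed.

Lemma hpmi1x x : 1 ⇝ x = x.
Proof. by rewrite -[LHS]hmul1x -hdivlr himpx1 hmul1x. Qed.

Lemma hpmix1 x : x ⇝ 1 = 1.
Proof.
have E : x ⊙ (x ⇝ 1) = x by rewrite hdivCr hmul1x hpmi1x.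
by rewrite -{1}E hpmiM hpmixx.
Qed.

Lemma hleE x y : x ≤ y <-> x ⇝ y = 1.
Proof.
split=> xy.
  have <- : y ⊙ (y ⇝ x) = x by rewrite -hdivlr xy hmul1x.
  by rewrite hpmiM hpmixx hpmix1.
have <- : (y → x) ⊙ y = x by rewrite hdivlr xy hmulx1.
by rewrite /hle himpM himpxx himpx1.
Qed.

Lemma hle_refl x : x ≤ x. Proof. exact: himpxx. Qed.

Lemma hle_trans y x z : x ≤ y -> y ≤ z -> x ≤ z.
Proof.
move=> xy yz; have <- : (y → x) ⊙ y = x by rewrite hdivC xy hmul1x.
by rewrite /hle himpM yz himpx1.
Qed.

Lemma hresl x y z : x ⊙ y ≤ z <-> x ≤ y → z.
Proof. by rewrite /hle himpM. Qed.

Lemma hresr x y z : x ⊙ y ≤ z <-> y ≤ x ⇝ z.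
Proof. by rewrite !hleE hpmiM. Qed.

Lemma hmulA x y z : x ⊙ (y ⊙ z) = x ⊙ y ⊙ z.
Proof.
have E w : (x ⊙ (y ⊙ z)) → w = (x ⊙ y ⊙ z) → w by rewrite !himpM.
by apply: hle_anti; rewrite /hle ?E ?himpxx // -E himpxx.
Qed.

Lemma himp_intro x y z : x ⊙ y ≤ z -> x ≤ y → z.
Proof. by rewrite hresl. Qed.

Lemma hpmi_intro x y z : x ⊙ y ≤ z -> y ≤ x ⇝ z.
Proof. by rewrite hresr. Qed.

Lemma hle_mul2r z x y : x ≤ y -> x ⊙ z ≤ y ⊙ z.
Proof.
by move=> xy; apply/hresl; apply: hle_trans xy _; apply/hresl; apply: hle_refl.
Qed.

Lemma hle_mul2l z x y : x ≤ y -> z ⊙ x ≤ z ⊙ y.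
Proof.
by move=> xy; apply/hresr; apply: hle_trans xy _; apply/hresr; apply: hle_refl.
Qed.

Lemma hmpl x y : (x → y) ⊙ x ≤ y.
Proof. by apply/hresl; apply: hle_refl. Qed.

Lemma hmpr x y : x ⊙ (x ⇝ y) ≤ y.
Proof. by apply/hresr; apply: hle_refl. Qed.

Lemma himp_trans x y z : (y → z) ⊙ (x → y) ≤ x → z.
Proof.
apply: himp_intro; rewrite -hmulA; apply: hle_trans (hmpl y z).
exact/hle_mul2l/hmpl.
Qed.

Lemma hpmi_trans x y z : (x ⇝ y) ⊙ (y ⇝ z) ≤ x ⇝ z.
Proof.
apply: hpmi_intro; rewrite hmulA; apply: hle_trans (hmpr y z).
exact/hle_mul2r/hmpr.
Qed.

End Theory.

Section Quotient.
Variables (A : pseudoHoopType) (F : set A) (hF : normal_filter F).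
Implicit Types x y z : A.

Definition Theta x y : Prop := F (x → y) /\ F (y → x).

Lemma filterM x y : F x -> F y -> F (x ⊙ y).
Proof. by case: hF => [[_ h _] _]; apply: h. Qed.

Lemma filter_up x y : F x -> x ≤ y -> F y.
Proof. by case: hF => [[_ _ h] _]; apply: h. Qed.

Lemma filter_normal x y : F (x → y) <-> F (x ⇝ y).
Proof. by case: hF. Qed.

Lemma filter1 : F 1.
Proof.
by case: hF => [[[x Fx] _ _] _]; apply: filter_up Fx _; apply: himpx1.
Qed.

Lemma Theta_refl x : Theta x x.
Proof. by split; rewrite himpxx; apply: filter1. Qed.

Lemma Theta_sym x y : Theta x y -> Theta y x.
Proof. by case. Qed.

Lemma Theta_trans y x z : Theta x y -> Theta y z -> Theta x z.
Proof.
move=> [xy yx] [yz zy]; split.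
  exact: filter_up (filterM yz xy) (himp_trans _ _ _).
exact: filter_up (filterM yx zy) (himp_trans _ _ _).
Qed.

Lemma Theta_mul x x' y y' : Theta x x' -> Theta y y' -> Theta (x ⊙ y) (x' ⊙ y').
Proof.
have H1 a b c : F (a → b) -> F (a ⊙ c → b ⊙ c).
  move=> ab; apply: filter_up ab _; apply: himp_intro; rewrite hmulA.
  exact/hle_mul2r/hmpl.
have H2 a b c : F (a → b) -> F (c ⊙ a → c ⊙ b).
  move=> /filter_normal ab; apply/filter_normal; apply: filter_up ab _.
  by apply: hpmi_intro; rewrite -hmulA; apply/hle_mul2l/hmpr.
move=> [xx' x'x] [yy' y'y]; apply: (@Theta_trans (x' ⊙ y)); split; auto.
Qed.

Lemma Theta_imp x x' y y' : Theta x x' -> Theta y y' -> Theta (x → y) (x' → y').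
Proof.
have H1 a b c : F (a → b) -> F ((b → c) → (a → c)).
  move=> ab; apply/filter_normal; apply: filter_up ab _.
  exact/hpmi_intro/himp_trans.
have H2 a b c : F (a → b) -> F ((c → a) → (c → b)).
  by move=> ab; apply: filter_up ab _; apply/himp_intro/himp_trans.
move=> [xx' x'x] [yy' y'y]; apply: (@Theta_trans (x' → y)); split; auto.
Qed.

Lemma Theta_pmi x x' y y' : Theta x x' -> Theta y y' -> Theta (x ⇝ y) (x' ⇝ y').
Proof.
have H1 a b c : F (a → b) -> F ((b ⇝ c) → (a ⇝ c)).
  move=> /filter_normal ab; apply: filter_up ab _.
  exact/himp_intro/hpmi_trans.
have H2 a b c : F (a → b) -> F ((c ⇝ a) → (c ⇝ b)).
  move=> /filter_normal ab; apply/filter_normal; apply: filter_up ab _.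
  exact/hpmi_intro/hpmi_trans.
move=> [xx' x'x] [yy' y'y]; apply: (@Theta_trans (x' ⇝ y)); split; auto.
Qed.

(* [eq_quot] requires a boolean relation over a choiceType *)
Definition Theta_rel : rel {classic A} := fun x y => `[< Theta x y >].

Lemma Theta_rel_refl : reflexive Theta_rel.
Proof. by move=> x; apply/asboolP; apply: Theta_refl. Qed.

Lemma Theta_rel_sym : symmetric Theta_rel.
Proof. by move=> x y; apply/asboolP/asboolP; apply: Theta_sym. Qed.

Lemma Theta_rel_trans : transitive Theta_rel.
Proof.
by move=> y x z /asboolP xy /asboolP yz; apply/asboolP; apply: Theta_trans yz.
Qed.

Definition Theta_equiv : equiv_rel {classic A} :=
  EquivRel Theta_rel Theta_rel_refl Theta_rel_sym Theta_rel_trans.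

Definition hquot : Type := {eq_quot Theta_equiv}.

Definition hclass (x : A) : hquot := \pi_{eq_quot Theta_equiv} (x : {classic A}).
Definition hrepr (X : hquot) : A := repr (X : {eq_quot Theta_equiv}).

Lemma hreprK X : hclass (hrepr X) = X.
Proof. exact: reprK. Qed.

Lemma hclassP x y : hclass x = hclass y <-> Theta x y.
Proof.
by split=> [/eqmodP/asboolP //|xy]; apply/eqmodP/asboolP.
Qed.

Lemma hclassK x : Theta (hrepr (hclass x)) x.
Proof. by apply/hclassP; rewrite hreprK. Qed.

Definition qmul X Y : hquot := hclass (hrepr X ⊙ hrepr Y).
Definition qimp X Y : hquot := hclass (hrepr X → hrepr Y).
Definition qpmi X Y : hquot := hclass (hrepr X ⇝ hrepr Y).

Lemma qmulE x y : qmul (hclass x) (hclass y) = hclass (x ⊙ y).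
Proof. by apply/hclassP/Theta_mul; apply: hclassK. Qed.
Lemma qimpE x y : qimp (hclass x) (hclass y) = hclass (x → y).
Proof. by apply/hclassP/Theta_imp; apply: hclassK. Qed.
Lemma qpmiE x y : qpmi (hclass x) (hclass y) = hclass (x ⇝ y).
Proof. by apply/hclassP/Theta_pmi; apply: hclassK. Qed.

Definition qE := (qmulE, qimpE, qpmiE).

Fact qmulx1 X : qmul X (hclass 1) = X.
Proof. by rewrite -(hreprK X) qE hmulx1. Qed.
Fact qmul1x X : qmul (hclass 1) X = X.
Proof. by rewrite -(hreprK X) qE hmul1x. Qed.
Fact qimpxx X : qimp X X = hclass 1.
Proof. by rewrite -(hreprK X) qE himpxx. Qed.
Fact qpmixx X : qpmi X X = hclass 1.
Proof. by rewrite -(hreprK X) qE hpmixx. Qed.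
Fact qimpM X Y Z : qimp (qmul X Y) Z = qimp X (qimp Y Z).
Proof. by rewrite -(hreprK X) -(hreprK Y) -(hreprK Z) !qE himpM. Qed.
Fact qpmiM X Y Z : qpmi (qmul X Y) Z = qpmi Y (qpmi X Z).
Proof. by rewrite -(hreprK X) -(hreprK Y) -(hreprK Z) !qE hpmiM. Qed.
Fact qdivC X Y : qmul (qimp X Y) X = qmul (qimp Y X) Y.
Proof. by rewrite -(hreprK X) -(hreprK Y) !qE hdivC. Qed.
Fact qdivlr X Y : qmul (qimp Y X) Y = qmul X (qpmi X Y).
Proof. by rewrite -(hreprK X) -(hreprK Y) !qE hdivlr. Qed.
Fact qdivCr X Y : qmul X (qpmi X Y) = qmul Y (qpmi Y X).
Proof. by rewrite -(hreprK X) -(hreprK Y) !qE hdivCr. Qed.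

HB.instance Definition _ := isPseudoHoop.Build hquot
  qmulx1 qmul1x qimpxx qpmixx qimpM qpmiM qdivC qdivlr qdivCr.

Lemma hclassM x y : hclass (x ⊙ y) = hclass x ⊙ hclass y.
Proof. by rewrite -qmulE. Qed.
Lemma hclass_imp x y : hclass (x → y) = hclass x → hclass y.
Proof. by rewrite -qimpE. Qed.
Lemma hclass_pmi x y : hclass (x ⇝ y) = hclass x ⇝ hclass y.
Proof. by rewrite -qpmiE. Qed.
Lemma hclass1 : hclass 1 = 1.
Proof. by []. Qed.

End Quotient.

(* Main.v *)
Require Import Defs.
From mathcomp Require Import all_boot.

(** Every type II operator is already of type I: it is monotone and satisfies
  [mu (y ∨₁ x) = mu y] whenever [x ≤ y]; since [w := y ∨₁ x] is an upper bound
  of [x] and [y], antitonicity gives [x ∨₁ y ≤ w ∨₁ y], hence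
  [mu (x ∨₁ y) ≤ mu w], and by symmetry [mu (x ∨₁ y) = mu (y ∨₁ x)].
  Moreover [mu] is constant on the classes of its kernel, so the identities of
  type II pass to the quotient; idempotence of [mu] makes the kernel of the
  induced operator the trivial, hence normal, filter. *)

Set Implicit Arguments.
Unset Strict Implicit.
Unset Printing Implicit Defensive.

Local Open Scope hoop_scope.

Section Joins.
Variable A : pseudoHoopType.
Implicit Types x y z : A.

Lemma hmul_lel x y : x ⊙ y ≤ x.
Proof. by apply/hresr; rewrite hpmixx; exact: himpx1. Qed.

Lemma hmul_ler x y : x ⊙ y ≤ y.
Proof. by apply/hresl; rewrite himpxx; exact: himpx1. Qed.

Lemma hle_hvee1l x y : x ≤ x ∨₁ y.
Proof. exact/hpmi_intro/hmpl. Qed.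

Lemma hle_hvee1r x y : y ≤ x ∨₁ y.
Proof. exact/hpmi_intro/hmul_ler. Qed.

Lemma hle_hvee2l x y : x ≤ x ∨₂ y.
Proof. exact/himp_intro/hmpr. Qed.

Lemma hle_hvee2r x y : y ≤ x ∨₂ y.
Proof. exact/himp_intro/hmul_lel. Qed.

Lemma hle_imp2r z x y : x ≤ y -> y → z ≤ x → z.
Proof.
move=> xy; apply: himp_intro; apply: hle_trans (hmpl y z).
exact: hle_mul2l.
Qed.

Lemma hle_pmi2r z x y : x ≤ y -> y ⇝ z ≤ x ⇝ z.
Proof.
move=> xy; apply: hpmi_intro; apply: hle_trans (hmpr y z).
exact: hle_mul2r.
Qed.

Lemma hle_hvee1 z x y : x ≤ y -> x ∨₁ z ≤ y ∨₁ z.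
Proof. by move=> /(hle_imp2r z)/(hle_pmi2r z). Qed.

Lemma hle_hvee2 z x y : x ≤ y -> x ∨₂ z ≤ y ∨₂ z.
Proof. by move=> /(hle_pmi2r z)/(hle_imp2r z). Qed.

End Joins.

Section TypeII.
Variables (A : pseudoHoopType) (mu : A -> A).
Hypothesis mu_II : state_operator_II mu.
Implicit Types x y : A.

Lemma state_II_1 : mu 1 = 1.
Proof.
case: mu_II => h _ _ _; have [] := h 1 1.
by rewrite /hvee1 himpxx hpmixx himpxx.
Qed.

(** (IS4) at the pair [1], [x], with [mu 1 = 1]. *)
Lemma state_II_idem x : mu (mu x) = mu x.
Proof.
by case: mu_II => _ _ _ h; have [] := h 1 x; rewrite state_II_1 himp1x.
Qed.

(** Divisibility writes [x] as [y ⊙ (y ⇝ x)], so (IS2) makes [mu y] a left factor of [mu x]. *)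
Lemma state_II_le x y : x ≤ y -> mu x ≤ mu y.
Proof.
move=> xy; have Ex : y ⊙ (y ⇝ x) = x by rewrite -hdivlr xy hmul1x.
case: mu_II => _ h _ _; have [] := h y (y ⇝ x).
by rewrite Ex => -> _; apply: hmul_lel.
Qed.

Lemma state_II_hvee1 x y : x ≤ y -> mu (y ∨₁ x) ≤ mu y.
Proof.
move=> xy; case: mu_II => h _ _ _; have [] := h x y.
by rewrite xy state_II_1.
Qed.

Lemma state_II_hvee2 x y : x ≤ y -> mu (y ∨₂ x) ≤ mu y.
Proof.
move=> /hleE xy; case: mu_II => h _ _ _; have [_] := h x y.
by rewrite xy state_II_1 => /esym/hleE.
Qed.

Lemma state_II_hvee1C x y : mu (x ∨₁ y) = mu (y ∨₁ x).
Proof.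
suff le u v : mu (u ∨₁ v) ≤ mu (v ∨₁ u) by apply: hle_anti.
(* The middle term is [mu ((v ∨₁ u) ∨₁ v)]: [v ≤ v ∨₁ u] bounds it above, [u ≤ v ∨₁ u] below. *)
apply: hle_trans (state_II_hvee1 (hle_hvee1l v u)).
exact/state_II_le/hle_hvee1/hle_hvee1r.
Qed.

Lemma state_II_hvee2C x y : mu (x ∨₂ y) = mu (y ∨₂ x).
Proof.
suff le u v : mu (u ∨₂ v) ≤ mu (v ∨₂ u) by apply: hle_anti.
apply: hle_trans (state_II_hvee2 (hle_hvee2l v u)).
exact/state_II_le/hle_hvee2/hle_hvee2r.
Qed.

Lemma state_II_I : state_operator_I mu.
Proof.
case: (mu_II) => h1 h2 h3 h4; split=> // x y.
by rewrite state_II_hvee1C state_II_hvee2C; apply: h1.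
Qed.

(** By (IS1'), [mu (x → y) = 1] says [mu (y ∨₁ x) ≤ mu y], and [y ∨₁ x] lies above [x]. *)
Lemma state_II_Ker_le x y : Ker mu (x → y) -> mu x ≤ mu y.
Proof.
case: mu_II => h _ _ _; rewrite /Ker /=; have [-> _] := h x y => le_y.
exact: hle_trans (state_II_le (hle_hvee1r y x)) le_y.
Qed.

Lemma state_II_Theta x y : Theta (Ker mu) x y -> mu x = mu y.
Proof. by case=> xy yx; apply: hle_anti; apply: state_II_Ker_le. Qed.

End TypeII.

(** Normality: each of the two implications equals [1] exactly when [x ≤ y]. *)
Lemma one_normal_filter (A : pseudoHoopType) (F : A -> Prop) :
  (forall x, F x <-> x = 1) -> normal_filter F.
Proof.
move=> FE; split; first split.
- by exists 1; apply/FE.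
- by move=> x y /FE -> /FE ->; apply/FE; rewrite hmulx1.
- by move=> x y /FE ->; rewrite /hle himp1x => ->; apply/FE.
by move=> x y; rewrite !FE; apply: hleE.
Qed.

Theorem theorem5p16 (A : pseudoHoopType) (mu : A -> A)
    (Hmu : state_operator_II mu) (HK : compatible mu) :
  (exists hatmu : hquot HK -> hquot HK,
     [/\ forall x : A, hatmu (hclass HK x) = hclass HK (mu x),
         compatible hatmu,
         state_operator_I hatmu &
         state_operator_II hatmu]) /\
  (compatible mu /\ state_operator_I mu).
Proof.
split; last by split=> //; apply: state_II_I.
pose hatmu (X : hquot HK) := hclass HK (mu (hrepr X)).
have hatE x : hatmu (hclass HK x) = hclass HK (mu x).
  (* The chosen representative is congruent to [x], so [mu] agrees on both. *)
  by congr (hclass _ _); apply: (state_II_Theta Hmu); apply: hclassK.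
have hat_II : state_operator_II hatmu.
  case: (Hmu) => h1 h2 h3 h4.
  (* Pulling [hclass] outwards reduces each identity to the one for [mu]. *)
  split=> X Y; rewrite -(hreprK X) -(hreprK Y) /hvee1 /hvee2;
    move: (hrepr X) (hrepr Y) => x y;
    rewrite !(hatE, =^~ hclassM, =^~ hclass_imp, =^~ hclass_pmi).
  - by have [<- <-] := h1 x y.
  - by have [<- <-] := h2 x y.
  - by rewrite h3.
  - by have [-> ->] := h4 x y.
exists hatmu; split=> //; last exact: state_II_I.
apply: one_normal_filter => X; split=> [|->]; last exact: (state_II_1 hat_II).
rewrite -(hreprK X); move: (hrepr X) => x; rewrite /Ker /= hatE -hclass1.
(* [mu x] congruent to [1] gives [mu (mu x) = mu 1], so [mu x = 1]: [x] is in the kernel, hence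
   congruent to [1]. *)
move=> /hclassP/(state_II_Theta Hmu).
rewrite (state_II_idem Hmu) (state_II_1 Hmu) => mux.
by apply/hclassP; split; rewrite ?himp1x // himpx1; apply: filter1.
Qed.
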